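(* Let $h_1,h_2:\mathbb{R}^m\to\mathbb{R}$ and $g_1,g_2:\mathbb{R}^d\to\mathbb{R}^m$ satisfy the standing assumptions given in the context, and put $f_i=h_i\circ g_i$ and $\rho:=L\beta$. Let $\mu>0$ and $t>0$ satisfy $\mu^{-1}>\max\{1,\rho\}$ and $t^{-1}\ge\mu^{-1}+\rho$, let $c:=\mu^{-1}-\rho$ and $L_\mu:=\frac{2}{\mu-\mu^2\rho}$, and set $$\gamma=\min\left\{\frac{1}{4L_\mu},\ \sqrt{\frac{t^3c^4\mu^3}{48(1-t^2c^2)}}\right\}$$ (the second entry being read as $+\infty$ if $tc=1$). Let $x_1^1,x_2^1,z^1\in\mathbb{R}^d$. Then there is a constant $M$, independent of $\epsilon$, such that for every $\epsilon\in(0,1]$ there is an integer $K\ge1$ with $K\le M/\epsilon^2$ (i.e. $K=O(1/\epsilon^2)$) for which the output $x_1^{\tau+1}$ of the Prox-Linear Approximate Gradient Method (described in the context), run from $x_1^1,x_2^1,z^1$ with parameters $K,t,\mu,\gamma$, is a stochastic nearly $2\epsilon$-critical point of $\min_x\{h_2(g_2(x))-h_1(g_1(x))\}$.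
   Context: Norms are Euclidean; $\nabla g_i(x)$ denotes the $m\times d$ Jacobian of $g_i$ at $x$. Standing assumptions, for $i=1,2$. (1) $h_i:\mathbb{R}^m\to\mathbb{R}$ is convex and $L$-Lipschitz continuous (and the proximal mapping of $x\mapsto h_i(Ax+b)$ is assumed computable for every $A\in\mathbb{R}^{m\times d}$, $b\in\mathbb{R}^m$). (2) $g_i:\mathbb{R}^d\to\mathbb{R}^m$ is $C^1$ with $\beta$-Lipschitz Jacobian, i.e. $\|\nabla g_i(x)-\nabla g_i(y)\|_{\mathrm{op}}\le\beta\|x-y\|$ for all $x,y$; and there is a constant $C_g$ with $\max\{\|g_1(x)\|,\|g_2(x)\|\}\le C_g$ for all $x\in\mathbb{R}^d$. Limiting subdifferential: for $f:\mathbb{R}^d\to\mathbb{R}$, the Fréchet subdifferential is $\hat\partial f(\bar x)=\{v:\liminf_{x\to\bar x}\frac{f(x)-f(\bar x)-v^\top(x-\bar x)}{\|x-\bar x\|}\ge0\}$, and $\partial f(\bar x)$ is the set of all $v$ for which there are $x_k\to\bar x$ with $f(x_k)\to f(\bar x)$ and $v_k\in\hat\partial f(x_k)$ with $v_k\to v$. Stochastic nearly $\epsilon$-critical point: a random variable $x$ in $\mathbb{R}^d$ is a stochastic nearly $\epsilon$-critical point of $\min_x\{f_2(x)-f_1(x)\}$ if there exist random variables $\xi_1,\xi_2,x',x''\in\mathbb{R}^d$ such that $\xi_1\in\partial f_1(x')$, $\xi_2\in\partial f_2(x'')$ and $\max\{\mathbb{E}\|\xi_1-\xi_2\|,\mathbb{E}\|x-x'\|,\mathbb{E}\|x-x''\|\}\le\epsilon$.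 Prox-Linear Approximate Gradient Method. Input: $x_1^1,x_2^1,z^1\in\mathbb{R}^d$, $K\in\mathbb{Z}_+$, $t,\mu,\gamma>0$. For $k=1,\dots,K$: for $i=1,2$ set $$x_i^{k+1}=\arg\min_x\left\{h_i\left(g_i(x_i^k)+\nabla g_i(x_i^k)(x-x_i^k)\right)+\tfrac1\mu\langle x_i^k-z^k,x-x_i^k\rangle+\tfrac{1}{2t}\|x-x_i^k\|^2\right\},$$ and then $z^{k+1}=z^k-\gamma\mu^{-1}(x_1^{k+1}-x_2^{k+1})$. Output: $x_1^{\tau+1}$ with $\tau$ uniformly sampled from $\{1,\dots,K\}$ (superscripts are iteration indices). Expectations are over $\tau$. *)

(* Defs.v *)
From HB Require Import structures.
From mathcomp Require Import all_boot all_order all_algebra.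
From mathcomp Require Import all_classical all_reals all_analysis.

Set Implicit Arguments.
Unset Strict Implicit.
Unset Printing Implicit Defensive.

Import Order.TTheory GRing.Theory Num.Theory.
Import numFieldNormedType.Exports.

Local Open Scope classical_set_scope.
Local Open Scope ring_scope.

(* Vectors of R^n are row vectors 'rV[R]_n.  The library's norm on matrices is
   the max norm, so the Euclidean norm and everything stated with it is defined
   here; limits and continuity use the library topology of 'rV[R]_n, which is
   the Euclidean one. *)
Definition dotp (R : realType) (n : nat) (u v : 'rV[R]_n) : R :=
  \sum_i u 0 i * v 0 i.

Definition enorm (R : realType) (n : nat) (v : 'rV[R]_n) : R :=
  Num.sqrt (\sum_i v 0 i ^+ 2).

Definition opnorm (R : realType) (n p : nat) (A : 'M[R]_(n, p)) : R :=
  sup [set enorm (v *m A) | v in [set v : 'rV[R]_n | enorm v <= 1]].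

Definition elipschitz (R : realType) (n : nat) (L : R) (h : 'rV[R]_n -> R) :
    Prop :=
  forall x y, `|h x - h y| <= L * enorm (x - y).

(* [jacobian g x] is the transpose of the usual Jacobian matrix: it acts on row
   vectors on the right, [v *m jacobian g x] being the derivative of [g] at [x]
   in the direction [v]. *)
Definition C1_lipschitz_jacobian (R : realType) (d m : nat) (beta : R)
    (g : 'rV[R]_d -> 'rV[R]_m) : Prop :=
  [/\ forall x, differentiable g x,
      continuous (jacobian g) &
      forall x y, opnorm (jacobian g x - jacobian g y) <= beta * enorm (x - y)].

Definition standing_assumptions (R : realType) (d m : nat) (L beta Cg : R)
    (h : 'rV[R]_m -> R) (g : 'rV[R]_d -> 'rV[R]_m) : Prop :=
  [/\ convex_function [set: 'rV[R]_m] h,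
      elipschitz L h,
      C1_lipschitz_jacobian beta g &
      forall x, enorm (g x) <= Cg].

Definition frechet_subdiff (R : realType) (d : nat) (f : 'rV[R]_d -> R)
    (xbar : 'rV[R]_d) : set 'rV[R]_d :=
  [set v | (0 <= limf_einf (fun x : 'rV[R]_d =>
      ((f x - f xbar - dotp v (x - xbar)) / enorm (x - xbar))%:E) xbar^')%E].

Definition limiting_subdiff (R : realType) (d : nat) (f : 'rV[R]_d -> R)
    (xbar : 'rV[R]_d) : set 'rV[R]_d :=
  [set v | exists x_ v_ : nat -> 'rV[R]_d,
    [/\ x_ @ \oo --> xbar,
        f \o x_ @ \oo --> f xbar,
        forall k, frechet_subdiff f (x_ k) (v_ k) &
        v_ @ \oo --> v]].

(* Measurability with respect to the Borel sigma-algebra of R^n. *)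
Definition random_vector (disp : measure_display) (T : measurableType disp)
    (R : realType) (n : nat) (X : T -> 'rV[R]_n) : Prop :=
  measurable_fun [set: T]
    (X : T -> g_sigma_algebraType (@open 'rV[R]_n)).

Definition stochastic_nearly_critical (R : realType) (d : nat)
    (disp : measure_display) (T : measurableType disp) (P : probability T R)
    (f1 f2 : 'rV[R]_d -> R) (eps : R) (x : T -> 'rV[R]_d) : Prop :=
  random_vector x /\
  exists xi1 xi2 x' x'' : T -> 'rV[R]_d,
    [/\ [/\ random_vector xi1, random_vector xi2,
            random_vector x' & random_vector x''],
        forall w, limiting_subdiff f1 (x' w) (xi1 w),
        forall w, limiting_subdiff f2 (x'' w) (xi2 w) &
        (maxe (maxe 'E_P[fun w => enorm (xi1 w - xi2 w)]
                    'E_P[fun w => enorm (x w - x' w)])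
              'E_P[fun w => enorm (x w - x'' w)] <= eps%:E)%E].

(* The default value 0 is returned only when there is no minimizer, which does
   not happen for the strongly convex objectives minimized below. *)
Definition argmin (R : realType) (d : nat) (F : 'rV[R]_d -> R) : 'rV[R]_d :=
  xget 0 [set x | forall y, F x <= F y].

Definition prox_linear_update (R : realType) (d m : nat)
    (h : 'rV[R]_m -> R) (g : 'rV[R]_d -> 'rV[R]_m) (t mu : R)
    (xk zk : 'rV[R]_d) : 'rV[R]_d :=
  argmin (fun x => h (g xk + (x - xk) *m jacobian g xk)
                   + mu^-1 * dotp (xk - zk) (x - xk)
                   + (2 * t)^-1 * enorm (x - xk) ^+ 2).

Record plag_state (R : realType) (d : nat) := PlagState {
  plag_x1 : 'rV[R]_d;
  plag_x2 : 'rV[R]_d;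
  plag_z : 'rV[R]_d }.

Definition plag_step (R : realType) (d m : nat) (h1 h2 : 'rV[R]_m -> R)
    (g1 g2 : 'rV[R]_d -> 'rV[R]_m) (t mu gamma : R) (s : plag_state R d) :
    plag_state R d :=
  let x1 := prox_linear_update h1 g1 t mu (plag_x1 s) (plag_z s) in
  let x2 := prox_linear_update h2 g2 t mu (plag_x2 s) (plag_z s) in
  PlagState x1 x2 (plag_z s - (gamma * mu^-1) *: (x1 - x2)).

(* [plag_iterate .. s0 k] is the state (x_1^{k+1}, x_2^{k+1}, z^{k+1}) reached
   after k iterations from s0 = (x_1^1, x_2^1, z^1). *)
Definition plag_iterate (R : realType) (d m : nat) (h1 h2 : 'rV[R]_m -> R)
    (g1 g2 : 'rV[R]_d -> 'rV[R]_m) (t mu gamma : R) (s0 : plag_state R d)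
    (k : nat) : plag_state R d :=
  iter k (plag_step h1 h2 g1 g2 t mu gamma) s0.

Definition uniform_on_1_to (R : realType) (disp : measure_display)
    (T : measurableType disp) (P : probability T R) (K : nat) (tau : T -> nat) :
    Prop :=
  measurable_fun [set: T] tau /\
  forall k : nat, P (tau @^-1` [set k]) =
    (if (1 <= k <= K)%N then K%:R^-1 else 0)%:E.

Definition plag_gamma (R : realType) (t mu rho : R) : R :=
  let c := mu^-1 - rho in
  let L_mu := 2 / (mu - mu ^+ 2 * rho) in
  if t * c == 1 then (4 * L_mu)^-1
  else Num.min (4 * L_mu)^-1
         (Num.sqrt (t ^+ 3 * c ^+ 4 * mu ^+ 3 / (48 * (1 - t ^+ 2 * c ^+ 2)))).

(* Main.v *)
Require Import Defs.
From HB Require Import structures.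
From mathcomp Require Import all_boot all_order all_algebra.
From mathcomp Require Import all_classical all_reals all_analysis.
From mathcomp Require Import ring lra.
Set Implicit Arguments.
Unset Strict Implicit.
Unset Printing Implicit Defensive.
Import Order.TTheory GRing.Theory Num.Theory.
Import numFieldNormedType.Exports.
Local Open Scope classical_set_scope.
Local Open Scope ring_scope.

(** Why the method works.  Write c = 1/mu - rho with rho = L * beta.  Each
    f_i = h_i o g_i differs from its linearization y |-> h_i (g_i x + g_i'(x)
    (y - x)) by at most rho/2 |y - x|^2, so f_i is rho-weakly convex
    ([composite_curvature_ge]), and y |-> f_i y + |y - z|^2 / (2 mu) is
    c-strongly convex.  Hence it has a minimizer p_i(z), which is a Lipschitz
    function of z with constant 1 / (mu c) ([prox_lipschitz]), and its minimal
    value, the Moreau envelope F_i(z), is smooth with gradient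
    (z - p_i(z)) / mu.  The gap Phi = F_2 - F_1 then has gradient
    (p_1(z) - p_2(z)) / mu, and it obeys the descent inequality
    [envelope_diff_descent] without any appeal to derivatives.

    The method is inexact gradient descent on Phi: the blocks x_1 and x_2 stand
    in for p_1(z) and p_2(z).  A prox-linear update minimizes a majorant of the
    proximal objective, and it multiplies the squared distance of x_i to p_i(z)
    by at most (1 - t c) / (1 + t c) ([update_contraction]).  When z moves,
    p_i(z) moves by a Lipschitz multiple of the step, so the tracking error is
    repaired faster than it is created as long as gamma is small.  This is
    quantified by the potential
    Phi(z) + a (|x_1 - p_1(z)|^2 + |x_2 - p_2(z)|^2): with
    kappa = gamma / mu^2, each iteration lowers it by at least
    kappa/2 |p_1(z) - p_2(z)|^2 + kappa |x_1^+ - p_1(z)|^2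
    ([potential_decrease]).  The potential is bounded below because the f_i are
    bounded, so these residuals have a finite sum, and the average over the
    first K iterations is O(1/K).

    A proximal point carries an exact subgradient: (z - p_i(z)) / mu lies in
    the limiting subdifferential of f_i at p_i(z) ([prox_subdiff]).  The
    witnesses of near-criticality at x_1^{k+1} are therefore x' = p_1(z^k),
    x'' = p_2(z^k) and these two subgradients, whose difference has norm
    |p_1(z^k) - p_2(z^k)| / mu.  Choosing K of order 1/eps^2 makes the mean
    squared residual at most (mu eps)^2, and since mu < 1 all three means are
    bounded by 2 eps: |x - x''| is at most the sum of the tracking error and of
    |p_1(z^k) - p_2(z^k)|, which is where the factor 2 comes from. *)

(** * Euclidean geometry of row vectors *)

Lemma dotpC (R : realType) n (u v : 'rV[R]_n) : dotp u v = dotp v u.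
Proof. by apply: eq_bigr => i _; rewrite mulrC. Qed.

Lemma dotpDl (R : realType) n (u v w : 'rV[R]_n) :
  dotp (u + v) w = dotp u w + dotp v w.
Proof. by rewrite -big_split; apply: eq_bigr => i _; rewrite mxE mulrDl. Qed.

Lemma dotpZl (R : realType) n a (u v : 'rV[R]_n) :
  dotp (a *: u) v = a * dotp u v.
Proof. by rewrite big_distrr; apply: eq_bigr => i _; rewrite /= mxE mulrA. Qed.

Lemma dotpNl (R : realType) n (u v : 'rV[R]_n) : dotp (- u) v = - dotp u v.
Proof. by rewrite -scaleN1r dotpZl mulN1r. Qed.

Lemma dotpDr (R : realType) n (u v w : 'rV[R]_n) :
  dotp u (v + w) = dotp u v + dotp u w.
Proof. by rewrite dotpC dotpDl !(dotpC u). Qed.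

Lemma dotpZr (R : realType) n a (u v : 'rV[R]_n) :
  dotp u (a *: v) = a * dotp u v.
Proof. by rewrite dotpC dotpZl (dotpC u). Qed.

Lemma dotpNr (R : realType) n (u v : 'rV[R]_n) : dotp u (- v) = - dotp u v.
Proof. by rewrite dotpC dotpNl (dotpC u). Qed.

Lemma dotp0l (R : realType) n (u : 'rV[R]_n) : dotp 0 u = 0.
Proof. by rewrite -(scale0r u) dotpZl mul0r. Qed.

Definition dotpE := (dotpDl, dotpDr, dotpNl, dotpNr, dotpZl, dotpZr).

Lemma enorm_ge0 (R : realType) n (v : 'rV[R]_n) : 0 <= enorm v.
Proof. exact: sqrtr_ge0. Qed.

Lemma sqr_enorm (R : realType) n (v : 'rV[R]_n) : enorm v ^+ 2 = dotp v v.
Proof.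
by rewrite sqr_sqrtr // sumr_ge0// => i _; exact: sqr_ge0.
Qed.

Lemma enormZ (R : realType) n a (v : 'rV[R]_n) :
  enorm (a *: v) = `|a| * enorm v.
Proof.
apply: (@pexpIrn _ 2) => //; rewrite ?nnegrE ?mulr_ge0 ?enorm_ge0//.
by rewrite exprMn !sqr_enorm !dotpE real_normK ?num_real// expr2 mulrA.
Qed.

Lemma enormN (R : realType) n (v : 'rV[R]_n) : enorm (- v) = enorm v.
Proof. by rewrite -scaleN1r enormZ normrN1 mul1r. Qed.

Lemma enormB (R : realType) n (u v : 'rV[R]_n) : enorm (u - v) = enorm (v - u).
Proof. by rewrite -opprB enormN. Qed.

Lemma enorm0 (R : realType) n : enorm (0 : 'rV[R]_n) = 0.
Proof. by rewrite -(scale0r 0) enormZ normr0 mul0r. Qed.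

Lemma normr_coord_le_enorm (R : realType) n (v : 'rV[R]_n) i :
  `|v 0 i| <= enorm v.
Proof.
rewrite -(@ler_pXn2r _ 2) ?nnegrE ?enorm_ge0// real_normK ?num_real//.
rewrite sqr_enorm /dotp (bigD1 i)//= -expr2 lerDl sumr_ge0// => j _.
exact: sqr_ge0.
Qed.

Lemma enorm_eq0 (R : realType) n (v : 'rV[R]_n) : enorm v = 0 -> v = 0.
Proof.
move=> v0; apply/rowP => i; rewrite mxE; apply/eqP; rewrite -normr_le0 -v0.
exact: normr_coord_le_enorm.
Qed.

Lemma cauchy_schwarz (R : realType) n (u v : 'rV[R]_n) :
  dotp u v <= enorm u * enorm v.
Proof.
have [/enorm_eq0 ->|u0] := eqVneq (enorm u) 0.
  by rewrite dotp0l mulr_ge0 ?enorm_ge0.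
have [/enorm_eq0 ->|v0] := eqVneq (enorm v) 0.
  by rewrite dotpC dotp0l mulr_ge0 ?enorm_ge0.
have uv0 : 0 < enorm u * enorm v.
  by rewrite lt0r mulf_neq0//= mulr_ge0 ?enorm_ge0.
have : 0 <= enorm (enorm v *: u - enorm u *: v) ^+ 2 by exact: sqr_ge0.
rewrite sqr_enorm !dotpE -!sqr_enorm (dotpC v u) => H.
rewrite -(ler_pM2l uv0); lra.
Qed.

Lemma ler_enormD (R : realType) n (u v : 'rV[R]_n) :
  enorm (u + v) <= enorm u + enorm v.
Proof.
rewrite -(@ler_pXn2r _ 2) ?nnegrE ?addr_ge0 ?enorm_ge0//.
rewrite sqrrD !sqr_enorm !dotpE (dotpC v u).
have := cauchy_schwarz u v.
lra.
Qed.

(** Norm-bounded sets of the library are bounded for the largest entry; this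
    comparison lets Euclidean balls be recognized as compact. *)
Lemma mx_norm_le_enorm (R : realType) n (v : 'rV[R]_n) : `|v| <= enorm v.
Proof.
rewrite [leLHS]/Num.norm /= mx_normrE; apply/bigmax_leP; split => [|[i j] _ /=].
  exact: enorm_ge0.
by rewrite ord1 normr_coord_le_enorm.
Qed.

Lemma continuous_enorm (R : realType) n : continuous (@enorm R n).
Proof.
move=> v.
apply: (@continuous_comp _ _ _ (fun v : 'rV[R]_n => \sum_i v 0 i ^+ 2)).
  apply: cvg_big => [||i _]; [exact: add_continuous|exact: nbhs_filter|].
  exact: (continuous_comp (@coord_continuous _ _ _ 0 i v)
    (@exprn_continuous R 2 (v 0 i))).
exact: sqrt_continuous.
Qed.

Lemma continuous_enormB (R : realType) n (x0 : 'rV[R]_n) :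
  continuous (fun x : 'rV[R]_n => enorm (x - x0)).
Proof.
have csub : continuous (fun x : 'rV[R]_n => x - x0).
  by move=> x; apply: (@cvgB _ _ _ (nbhs x)); [exact: cvg_id|exact: cvg_cst].
by move=> x; exact: (continuous_comp (csub x) (@continuous_enorm R n _)).
Qed.

(** The Frobenius norm of [A] is such a constant.  It shows that the supremum
    in [opnorm] is taken over a bounded set. *)
Lemma enorm_mulmx_bounded (R : realType) n p (A : 'M[R]_(n, p)) :
  exists C, forall v, enorm (v *m A) <= C * enorm v.
Proof.
exists (Num.sqrt (\sum_j enorm (col j A)^T ^+ 2)) => v.
rewrite -(@ler_pXn2r _ 2) ?nnegrE ?mulr_ge0 ?enorm_ge0 ?sqrtr_ge0//.
have S0 : 0 <= \sum_j enorm (col j A)^T ^+ 2.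
  by apply: sumr_ge0 => j _; exact: sqr_ge0.
rewrite exprMn (sqr_sqrtr S0).
rewrite sqr_enorm mulr_suml; apply: ler_sum => j _.
have -> : (v *m A) 0 j = dotp v (col j A)^T.
  by rewrite mxE; apply: eq_bigr => i _; rewrite !mxE.
rewrite -expr2 -exprMn -real_normK ?num_real//.
rewrite ler_pXn2r ?nnegrE ?mulr_ge0 ?enorm_ge0//.
rewrite mulrC ler_norml cauchy_schwarz andbT lerNl -dotpNl.
by rewrite -(enormN v) cauchy_schwarz.
Qed.

Lemma ler_opnorm (R : realType) n p (A : 'M[R]_(n, p)) v :
  enorm (v *m A) <= opnorm A * enorm v.
Proof.
have [/enorm_eq0 ->|v0] := eqVneq (enorm v) 0.
  by rewrite mul0mx !enorm0 mulr0.
have vgt0 : 0 < enorm v by rewrite lt0r v0 enorm_ge0.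
rewrite -ler_pdivrMr//; apply: sup_upper_bound.
  split; first by exists (enorm (0 *m A)), 0; rewrite //= enorm0.
  have [C hC] := enorm_mulmx_bounded A.
  exists `|C| => _ [w /= w1 <-]; apply: le_trans (hC _) _.
  apply: le_trans (ler_wpM2r (enorm_ge0 _) (ler_norm C)) _.
  by rewrite -[leRHS]mulr1 ler_wpM2l.
exists ((enorm v)^-1 *: v) => /=.
  by rewrite enormZ normfV gtr0_norm// mulVf.
by rewrite -scalemxAl enormZ normfV gtr0_norm// mulrC.
Qed.

(** * Curvature and minimizers *)

(** Strong convexity of modulus [sigma] when [sigma] is positive, convexity
    when it is 0, and weak convexity when it is negative.  Keeping one notion
    for all signs makes the modulus additive under adding a quadratic. *)
Definition curvature_ge (R : realType) n (sigma : R) (F : 'rV[R]_n -> R) :=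
  forall x y l, 0 <= l <= 1 ->
    F ((1 - l) *: x + l *: y) <=
      (1 - l) * F x + l * F y - sigma / 2 * (l * (1 - l)) * enorm (x - y) ^+ 2.

Lemma convex_curvature_ge0 (R : realType) n (h : 'rV[R]_n -> R) :
  convex_function [set: 'rV[R]_n] h -> curvature_ge 0 h.
Proof.
move=> hc x y l /andP[l0 l1].
pose p : {i01 R} := Itv01 l0 l1.
have := hc p y x; rewrite !in_setT => /(_ isT isT).
rewrite convRE /conv/= addrC !mul0r subr0 [leRHS]addrC.
exact.
Qed.

(** A Euclidean square satisfies the curvature inequality with equality, so
    moduli simply add up; this is why a weakly convex function plus a large
    enough square is strongly convex. *)
Lemma curvature_geD_sqr (R : realType) n (s a : R) (F : 'rV[R]_n -> R) z :
  curvature_ge s F ->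
  curvature_ge (s + a) (fun x => F x + a / 2 * enorm (x - z) ^+ 2).
Proof.
move=> cF x y l l01; have := cF x y l l01.
rewrite !sqr_enorm !dotpE (dotpC y x) (dotpC z x) (dotpC z y); lra.
Qed.

Lemma curvature_geD_linear (R : realType) n (s : R) (F : 'rV[R]_n -> R) p z :
  curvature_ge s F -> curvature_ge s (fun x => F x + dotp p (x - z)).
Proof.
move=> cF x y l l01; have := cF x y l l01.
rewrite !dotpE; lra.
Qed.

Lemma curvature_ge_affine (R : realType) n p (F : 'rV[R]_p -> R)
    (A : 'M[R]_(n, p)) b z :
  curvature_ge 0 F -> curvature_ge 0 (fun x : 'rV[R]_n => F (b + (x - z) *m A)).
Proof.
move=> cF x y l l01; have := cF (b + (x - z) *m A) (b + (y - z) *m A) l l01.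
rewrite !mul0r.
suff -> : (1 - l) *: (b + (x - z) *m A) + l *: (b + (y - z) *m A) =
          b + ((1 - l) *: x + l *: y - z) *m A by [].
rewrite !scalerDr addrACA -scalerDl subrK scale1r !scalemxAl -mulmxDl.
congr (_ + _ *m A); rewrite !scalerBr addrACA -opprD -scalerDl subrK.
by rewrite scale1r.
Qed.

(** Comparing the minimum with the value at a point of the segment towards
    [y], dividing by the position [l] on it and letting [l] tend to 0. *)
Lemma minimizer_growth (R : realType) n (s : R) (F : 'rV[R]_n -> R) x :
  curvature_ge s F -> (forall y, F x <= F y) ->
  forall y, F x + s / 2 * enorm (y - x) ^+ 2 <= F y.
Proof.
move=> cF xmin y; apply/ler_addgt0Pl => e e0.
set D := s / 2 * enorm (y - x) ^+ 2.
have [D0|D0] := leP D 0; first by have := xmin y; lra.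
(* A position so close to x that the loss l * D stays below e. *)
pose l := Num.min 1 (e / D).
have l0 : 0 < l by rewrite lt_min ltr01 divr_gt0.
have l1 : l <= 1 by rewrite ge_min lexx.
have lD : l * D <= e by rewrite -ler_pdivlMr// ge_min lexx orbT.
have l01 : 0 <= l <= 1 by rewrite ltW.
have := cF x y l l01; have := xmin ((1 - l) *: x + l *: y).
rewrite (enormB x y) => H1 H2.
have H3 : l * (F x + D - F y) <= l * (l * D) by rewrite /D; lra.
by rewrite ler_pM2l// in H3; lra.
Qed.

(** The square beats the at most linear decay of [F], so values outside a
    large ball exceed the value at [x0] and the minimum over the compact ball
    is global. *)
Lemma exists_minimizer (R : realType) n (F : 'rV[R]_n -> R) (A B a : R) x0 :
  continuous F -> (forall x, A - B * enorm (x - x0) <= F x) -> 0 < a ->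
  exists x, forall y,
    F x + a * enorm (x - x0) ^+ 2 <= F y + a * enorm (y - x0) ^+ 2.
Proof.
move=> cF lbF a0; pose G x := F x + a * enorm (x - x0) ^+ 2.
have cG : continuous G.
  move=> x; apply: (@cvgD _ _ _ (nbhs x)); first exact: cF.
  apply: (@cvgM _ _ (nbhs x)); first exact: cvg_cst.
  exact: (continuous_comp (@continuous_enormB R n x0 x)
    (@exprn_continuous R 2 _)).
(* Beyond this radius u, a * u - B is at least a + F x0 - A, which is at
   least F x0 - A, and u >= 1. *)
pose r := 1 + (`|B| + F x0 - A) / a.
have AF : A <= F x0 by have := lbF x0; rewrite subrr enorm0; lra.
have r1 : 1 <= r.
  by rewrite lerDl divr_ge0 ?(ltW a0)//; have := normr_ge0 B; lra.
pose K := [set x : 'rV[R]_n | enorm (x - x0) <= r].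
have Kx0 : K x0 by rewrite /K/= subrr enorm0; lra.
have cK : compact K.
  apply: bounded_closed_compact.
    exists (r + `|x0|); split; first exact: num_real.
    move=> M rM x /= Kx; apply: le_trans (ltW rM).
    rewrite -[x in leLHS](subrK x0); apply: le_trans (ler_normD _ _) _.
    by rewrite lerD2r; apply: le_trans (mx_norm_le_enorm _) Kx.
  apply: (preimage_closed _ (@closed_le R r)) => x _.
  exact: continuous_enormB.
have [x _ xmin] := EVT_min_rV (ex_intro _ _ Kx0) cK (continuous_subspaceT cG).
exists x => y.
have [Ky|Ky] := leP (enorm (y - x0)) r; first by apply: xmin; rewrite inE.
apply: (@le_trans _ _ (G x0)); first by apply: xmin; rewrite inE.
rewrite /G subrr enorm0 expr0n/= mulr0 addr0.
have := lbF y; set u := enorm (y - x0) in Ky *.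
have ar : a * r = a + `|B| + F x0 - A.
  by rewrite mulrDr mulr1 mulrCA divff ?gt_eqF// mulr1; lra.
have := ler_norm B.
have : a * r < a * u by rewrite ltr_pM2l.
nra.
Qed.

Lemma argmin_min (R : realType) n (F : 'rV[R]_n -> R) :
  (exists x, forall y, F x <= F y) -> forall y, F (argmin F) <= F y.
Proof. exact: xgetPex. Qed.

(** * Second-order Taylor estimate *)

(** Testing [g] against a fixed vector [w] along a line reduces vector-valued
    Taylor estimates to functions of one real variable. *)
Lemma is_derive_dotp_line (R : realType) d m (g : 'rV[R]_d -> 'rV[R]_m)
    x v w s :
  differentiable g (x + s *: v) ->
  is_derive s 1 (fun s : R => dotp (g (x + s *: v)) w)
    (dotp (v *m jacobian g (x + s *: v)) w).
Proof.
move=> dg; rewrite -(deriveEjacobian v dg).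
have cdotp : continuous (fun u : 'rV[R]_m => dotp u w).
  move=> u; apply: cvg_big => [||i _].
  - exact: add_continuous.
  - exact: nbhs_filter.
  by apply: (@cvgM _ _ (nbhs u)); [exact: coord_continuous|exact: cvg_cst].
have dotp_diff :
    h^-1 *: (((fun s : R => dotp (g (x + s *: v)) w) \o shift s) (h *: 1)
             - dotp (g (x + s *: v)) w) @[h --> 0^']
    --> dotp ('D_v g (x + s *: v)) w.
  rewrite [X in X @ _ --> _](_ : _ = (fun u => dotp u w) \o (fun h =>
      h^-1 *: ((g \o shift (x + s *: v)) (h *: v) - g (x + s *: v)))).
    exact: (continuous_cvg _ (cdotp _) (@diff_derivable _ _ _ _ _ v dg)).
  apply/funext => h /=; rewrite [h *: 1]mulr1 !dotpE/=.
  congr (_ * (dotp (g _) _ - _)).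
  by rewrite scalerDl addrCA.
apply: DeriveDef; first by apply/cvg_ex; eexists; exact: dotp_diff.
exact: cvg_lim dotp_diff.
Qed.

(** The mean value theorem applied to the error tested against itself: the
    derivative of [phi] below is nonpositive because the Jacobian at distance
    s |v| from [x] differs from the one at [x] by at most beta s |v|. *)
Lemma jacobian_taylor (R : realType) d m (beta : R) (g : 'rV[R]_d -> 'rV[R]_m) :
  0 <= beta -> C1_lipschitz_jacobian beta g -> forall x y,
  enorm (g y - (g x + (y - x) *m jacobian g x)) <=
    beta / 2 * enorm (y - x) ^+ 2.
Proof.
move=> b0 [dg _ lipJ] x y; set v := y - x; set w := g y - _.
pose J0 := dotp (v *m jacobian g x) w.
pose Q := beta / 2 * enorm v ^+ 2 * enorm w.
pose phi (s : R) := dotp (g (x + s *: v)) w - J0 * s - Q * s ^+ 2.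
have dphi s : is_derive s (1 : R) phi
   (dotp (v *m jacobian g (x + s *: v)) w - J0 - 2 * s * Q).
  apply: is_deriveB.
    apply: is_deriveB; first exact: is_derive_dotp_line.
    by apply: (is_derive_eq (is_deriveZ J0 (is_derive_id s 1))); exact: mulr1.
  apply: (is_derive_eq (is_deriveZ Q (is_deriveX 2 (is_derive_id s 1)))).
  by rewrite /= expr1 [_ *: 1]mulr1 [_ *: _]mulrC.
have phi10 : phi 1 <= phi 0.
  apply: (@ler0_derive1_le_cc R phi 0 1); rewrite ?in_itv/= ?lexx ?ler01//.
  - move=> s; rewrite in_itv/= => /andP[s0 _]; rewrite derive1E derive_val.
    rewrite subr_le0 -dotpNl -dotpDl -mulmxBr.
    apply: le_trans (cauchy_schwarz _ _) _.
    have -> : 2 * s * Q = s * (beta * enorm v ^+ 2) * enorm w.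
      by rewrite /Q; lra.
    apply: ler_wpM2r; first exact: enorm_ge0.
    apply: le_trans (ler_opnorm _ _) _.
    apply: le_trans (ler_wpM2r (enorm_ge0 _) (lipJ _ _)) _.
    by rewrite addrC addKr enormZ gtr0_norm//; lra.
  - apply: continuous_subspaceT => s.
    apply: differentiable_continuous; apply/derivable1_diffP.
    exact: ex_derive.
move: phi10; rewrite /phi /J0 /Q scale1r scale0r addr0 [x + v]addrC subrK.
rewrite expr1n expr0n/= !mulr1 !mulr0 !subr0.
have wE u : dotp w u = dotp (g y) u - dotp (g x) u - dotp (v *m jacobian g x) u.
  by rewrite /w opprD addrA !dotpE.
have := sqr_enorm w; rewrite wE => wE2 H.
have Q0 : 0 <= enorm w * (beta / 2 * enorm v ^+ 2 - enorm w) by lra.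
have [w0|w0] := eqVneq (enorm w) 0; last first.
  by rewrite -subr_ge0 -(@pmulr_rge0 _ (enorm w))// lt0r w0 enorm_ge0.
by rewrite w0 mulr_ge0 ?sqr_ge0 ?divr_ge0.
Qed.

(** * Convex-composite functions and their linearizations *)

Definition linearized (R : realType) d m (h : 'rV[R]_m -> R)
    (g : 'rV[R]_d -> 'rV[R]_m) (x y : 'rV[R]_d) : R :=
  h (g x + (y - x) *m jacobian g x).

Definition bounded_weakly_convex (R : realType) d (rho : R)
    (f : 'rV[R]_d -> R) :=
  [/\ continuous f, exists B, forall x, `|f x| <= B & curvature_ge (- rho) f].

Lemma elipschitz_continuous (R : realType) n (L : R) (h : 'rV[R]_n -> R) :
  elipschitz L h -> continuous h.
Proof.
move=> hL x; apply/(@cvgrPdist_le _ _ _ (nbhs x)) => e e0.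
have : \forall y \near x, enorm (y - x) < e / (1 + `|L|).
  have /(_ x)/cvgr_lt := @continuous_enormB R n x; apply.
  by rewrite subrr enorm0 divr_gt0// ltr_pwDl.
apply: filterS => y /ltW; rewrite ler_pdivlMr ?ltr_pwDl// => yx.
apply: le_trans (hL _ _) _; rewrite enormB.
have := ler_wpM2r (enorm_ge0 (y - x)) (ler_norm L).
have := enorm_ge0 (y - x); lra.
Qed.

Section standing.
Context (R : realType) (d m : nat) (L beta Cg : R)
    (h : 'rV[R]_m -> R) (g : 'rV[R]_d -> 'rV[R]_m)
    (L0 : 0 <= L) (b0 : 0 <= beta) (hyp : standing_assumptions L beta Cg h g).

Lemma linearized_error x y :
  `|h (g y) - linearized h g x y| <= L * beta / 2 * enorm (y - x) ^+ 2.
Proof.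
case: hyp => _ hL hg _; apply: le_trans (hL _ _) _.
have := ler_wpM2l L0 (jacobian_taylor b0 hg x y); rewrite !mulrA; exact.
Qed.

Lemma linearized_convex x : curvature_ge 0 (linearized h g x).
Proof.
case: hyp => hc _ _ _.
apply: curvature_ge_affine; exact: convex_curvature_ge0.
Qed.

Lemma linearized_continuous x : continuous (linearized h g x).
Proof.
case: hyp => _ hL _ _; have [C hC] := enorm_mulmx_bounded (jacobian g x).
apply: (@elipschitz_continuous _ _ (L * C)) => y z.
apply: le_trans (hL _ _) _.
rewrite opprD addrACA subrr add0r -mulmxBl opprB addrA subrK -mulrA.
exact: ler_wpM2l.
Qed.

Lemma linearized_minorant x :
  exists B, forall y, h (g x) - B * enorm (y - x) <= linearized h g x y.
Proof.
case: hyp => _ hL _ _; have [C hC] := enorm_mulmx_bounded (jacobian g x).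
exists (L * C) => y.
have H := hL (g x + (y - x) *m jacobian g x) (g x).
rewrite [X in enorm X]addrC addKr distrC in H.
have H2 := ler_wpM2l L0 (hC (y - x)).
have := le_trans (ler_norm _) H; rewrite /linearized; lra.
Qed.

(** At [w] between [x] and [y] the linearization at [w] is exact, and it is
    convex; replacing it by [h \o g] at [x] and [y] costs
    (1 - l) |x - w|^2 + l |y - w|^2 = l (1 - l) |x - y|^2 times rho/2. *)
Lemma composite_curvature_ge : curvature_ge (- (L * beta)) (h \o g).
Proof.
move=> x y l l01; set w := _ + _.
have Hx := linearized_error w x; have Hy := linearized_error w y.
have := linearized_convex w x y l01; rewrite -/w.
rewrite {1}/linearized subrr mul0mx addr0 mul0r mul0r mul0r subr0 => Hw.
have xwE : enorm (x - w) ^+ 2 = l ^+ 2 * enorm (x - y) ^+ 2.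
  suff -> : x - w = l *: (x - y) by rewrite enormZ exprMn real_normK ?num_real.
  by rewrite /w scalerBl scale1r scalerBr opprD opprB addrA addrCA subrr addr0.
have ywE : enorm (y - w) ^+ 2 = (1 - l) ^+ 2 * enorm (x - y) ^+ 2.
  rewrite enormB; suff -> : w - y = (1 - l) *: (x - y).
    by rewrite enormZ exprMn real_normK ?num_real.
  by rewrite /w scalerBr -addrA; congr (_ + _); rewrite scalerBl scale1r opprB.
case/andP: l01 => l0 l1.
rewrite distrC xwE in Hx; rewrite distrC ywE in Hy.
have l1' : 0 <= 1 - l by rewrite subr_ge0.
have := ler_wpM2l l1' (le_trans (ler_norm _) Hx).
have := ler_wpM2l l0 (le_trans (ler_norm _) Hy).
rewrite /=; move: Hw; lra.
Qed.

Lemma composite_bounded_weakly_convex :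
  bounded_weakly_convex (L * beta) (h \o g).
Proof.
case: hyp => _ hL [dg _ _] gC; split.
- move=> x; apply: (@continuous_comp _ _ _ g h).
    exact: differentiable_continuous.
  exact: elipschitz_continuous hL _.
- exists (`|h 0| + L * Cg) => x /=.
  have := hL (g x) 0; rewrite subr0 => H.
  have := ler_wpM2l L0 (gC x).
  have := ler_normD (h (g x) - h 0) (h 0); rewrite subrK; lra.
exact: composite_curvature_ge.
Qed.
End standing.

(** * Proximal points and Moreau envelopes *)

Definition prox (R : realType) d (mu : R) (f : 'rV[R]_d -> R) (z : 'rV[R]_d) :=
  argmin (fun x => f x + mu^-1 / 2 * enorm (x - z) ^+ 2).

Definition envelope (R : realType) d (mu : R) (f : 'rV[R]_d -> R) z :=
  f (prox mu f z) + mu^-1 / 2 * enorm (prox mu f z - z) ^+ 2.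

(** Strong convexity of the proximal objective at its minimizer.  All the
    later information on [prox] and [envelope] is drawn from this one
    inequality. *)
Lemma envelope_growth (R : realType) d (mu rho : R) (f : 'rV[R]_d -> R) z x :
  0 < mu -> bounded_weakly_convex rho f ->
  envelope mu f z + (mu^-1 - rho) / 2 * enorm (x - prox mu f z) ^+ 2
    <= f x + mu^-1 / 2 * enorm (x - z) ^+ 2.
Proof.
move=> mu0 [cf [B fB] wf].
rewrite [_ - rho]addrC.
apply: (minimizer_growth (curvature_geD_sqr mu^-1 z wf)).
apply: argmin_min; apply: (@exists_minimizer _ _ _ (- B) 0) => //.
  by move=> y; have := fB y; rewrite mul0r subr0 ler_norml => /andP[].
by rewrite divr_gt0 ?invr_gt0.
Qed.

Lemma envelope_le (R : realType) d (mu rho : R) (f : 'rV[R]_d -> R) z x :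
  0 < mu -> rho <= mu^-1 -> bounded_weakly_convex rho f ->
  envelope mu f z <= f x + mu^-1 / 2 * enorm (x - z) ^+ 2.
Proof.
move=> mu0 rmu af; apply: le_trans (envelope_growth z x mu0 af).
by rewrite lerDl mulr_ge0 ?sqr_ge0// divr_ge0// subr_ge0.
Qed.

(** Adding the growth inequalities at [z1] and [z2], each tested at the other
    proximal point, cancels the values of [f] and leaves strong monotonicity:
    c |p1 - p2|^2 <= <p1 - p2, z1 - z2> / mu. *)
Lemma prox_lipschitz (R : realType) d (mu rho : R) (f : 'rV[R]_d -> R) z1 z2 :
  0 < mu -> rho < mu^-1 -> bounded_weakly_convex rho f ->
  enorm (prox mu f z1 - prox mu f z2) <=
    (mu * (mu^-1 - rho))^-1 * enorm (z1 - z2).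
Proof.
move=> mu0 rmu af.
have := envelope_growth z1 (prox mu f z2) mu0 af.
have := envelope_growth z2 (prox mu f z1) mu0 af.
rewrite /envelope; move: (prox mu f z1) (prox mu f z2) => p1 p2.
have [->|p0] := eqVneq (enorm (p1 - p2)) 0.
  move=> _ _; rewrite mulr_ge0 ?enorm_ge0// invr_ge0.
  by rewrite mulr_ge0 ?ltW// subr_gt0.
rewrite (enormB p2 p1) => H1 H2.
have H : (mu^-1 - rho) * enorm (p1 - p2) ^+ 2 <=
    mu^-1 * dotp (p1 - p2) (z1 - z2).
  move: H1 H2; rewrite !sqr_enorm !dotpE.
  rewrite (dotpC z1 p2) (dotpC z1 p1) (dotpC z2 p1) (dotpC z2 p2) (dotpC p2 p1).
  lra.
have c0 : 0 < mu * (mu^-1 - rho) by rewrite mulr_gt0// subr_gt0.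
have pgt0 : 0 < enorm (p1 - p2) by rewrite lt0r p0 enorm_ge0.
rewrite ler_pdivlMl// -(ler_pM2r pgt0) -mulrA -expr2.
apply: le_trans (_ : dotp (p1 - p2) (z1 - z2) <= _); last first.
  by rewrite mulrC; exact: cauchy_schwarz.
by rewrite -(mulVKf (lt0r_neq0 mu0) (dotp _ _)) -mulrA ler_pM2l.
Qed.

(** The descent lemma for the gap between two envelopes, whose gradient is
    (p1 - p2) / mu.  The upper estimate of the second envelope keeps the old
    proximal point as a competitor at [z + D]; the lower estimate of the first
    one uses the new proximal point at [z], and is off by the displacement of
    that point, hence the Lipschitz constant. *)
Lemma envelope_diff_descent (R : realType) d (mu rho : R)
    (f1 f2 : 'rV[R]_d -> R) z D :
  0 < mu -> rho < mu^-1 ->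
  bounded_weakly_convex rho f1 -> bounded_weakly_convex rho f2 ->
  envelope mu f2 (z + D) - envelope mu f1 (z + D) <=
  envelope mu f2 z - envelope mu f1 z
  + mu^-1 * dotp (prox mu f1 z - prox mu f2 z) D
  + (mu ^+ 2 * (mu^-1 - rho))^-1 * enorm D ^+ 2.
Proof.
move=> mu0 rmu a1 a2.
have H2 := envelope_le (z + D) (prox mu f2 z) mu0 (ltW rmu) a2.
have H1 := envelope_le z (prox mu f1 (z + D)) mu0 (ltW rmu) a1.
have := ler_wpM2r (enorm_ge0 D) (prox_lipschitz (z + D) z mu0 rmu a1).
rewrite [z + D - z]addrC addKr -mulrA -expr2.
move=> /(le_trans (cauchy_schwarz _ _)) Hq.
have imu : 0 < mu^-1 by rewrite invr_gt0.
rewrite -(ler_pM2l imu) mulrA -invfM (mulrA mu) -expr2 in Hq.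
move: Hq H1 H2; rewrite /envelope; move: (_ ^+ 2 * _)^-1 => C.
move: (prox mu f1 (z + D)) (prox mu f2 (z + D)) => q q2.
move: (prox mu f1 z) (prox mu f2 z) => p1 p2.
move: (mu^-1) => imu'.
rewrite !sqr_enorm !dotpE.
rewrite ?(dotpC D) ?(dotpC z q) ?(dotpC z p1) ?(dotpC z p2).
lra.
Qed.

(** A quadratic minorant with slope [v] that touches [f] at [x] makes [v] a
    Frechet subgradient there, and constant sequences then do for the limiting
    subdifferential. *)
Lemma limiting_subdiff_minorant (R : realType) d (f : 'rV[R]_d -> R) a v x :
  (forall y, f x + dotp v (y - x) - a * enorm (y - x) ^+ 2 <= f y) ->
  limiting_subdiff f x v.
Proof.
move=> Hf; exists (fun=> x), (fun=> v); split; try exact: cvg_cst.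
move=> _; rewrite /frechet_subdiff/= limf_einfE.
apply/lee_addgt0Pr => e e0.
rewrite -leeBlDr// sub0e.
(* On this ball the quotient is at least - |a| * |y - x| >= - e. *)
pose V := [set y | enorm (y - x) < e / (1 + `|a|)].
pose quot y := ((f y - f x - dotp v (y - x)) / enorm (y - x))%:E.
apply: le_trans (_ : ereal_inf [set quot y | y in V] <= _)%E; last first.
  apply: ereal_sup_ubound; exists V => //; apply: nbhs_dnbhs.
  have /(_ x)/cvgr_lt := @continuous_enormB R d x; apply.
  by rewrite subrr enorm0 divr_gt0// ltr_pwDl.
apply/ereal_infP => _ [y Vy <-]; rewrite -EFinN lee_fin.
have [->|yx0] := eqVneq (enorm (y - x)) 0.
  by rewrite invr0 mulr0 lerNl oppr0 ltW.
have yx : 0 < enorm (y - x) by rewrite lt0r yx0 enorm_ge0.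
rewrite ler_pdivlMr//.
have := Hf y; move: Vy; rewrite /V/= ltr_pdivlMr ?ltr_pwDl// => Vy.
have := ler_norm a.
nra.
Qed.

(** Minimality of the proximal point says exactly that [f] has there a
    quadratic minorant with slope (z - p) / mu. *)
Lemma prox_subdiff (R : realType) d (mu rho : R) (f : 'rV[R]_d -> R) z :
  0 < mu -> rho <= mu^-1 -> bounded_weakly_convex rho f ->
  limiting_subdiff f (prox mu f z) (mu^-1 *: (z - prox mu f z)).
Proof.
move=> mu0 rmu af; apply: (@limiting_subdiff_minorant _ _ _ (mu^-1 / 2)) => y.
have := envelope_le z y mu0 rmu af; rewrite /envelope.
move: (prox mu f z) => p.
rewrite !sqr_enorm !dotpE (dotpC z y) (dotpC z p) (dotpC p y); lra.
Qed.

(** * The prox-linear update *)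

(** The objective minimized by [prox_linear_update], with the coefficient of
    the square in the form used for curvature. *)
Definition prox_linear_model (R : realType) d m (h : 'rV[R]_m -> R)
    (g : 'rV[R]_d -> 'rV[R]_m) (t mu : R) (x z y : 'rV[R]_d) : R :=
  linearized h g x y + mu^-1 * dotp (x - z) (y - x)
  + t^-1 / 2 * enorm (y - x) ^+ 2.

Section update.
Context (R : realType) (d m : nat) (L beta Cg : R)
    (h : 'rV[R]_m -> R) (g : 'rV[R]_d -> 'rV[R]_m)
    (L0 : 0 <= L) (b0 : 0 <= beta) (hyp : standing_assumptions L beta Cg h g)
    (t mu : R) (mu0 : 0 < mu) (t0 : 0 < t).

Lemma update_growth x z y :
  prox_linear_model h g t mu x z (prox_linear_update h g t mu x z)
  + t^-1 / 2 * enorm (y - prox_linear_update h g t mu x z) ^+ 2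
  <= prox_linear_model h g t mu x z y.
Proof.
set F := prox_linear_model h g t mu x z.
pose F0 y := linearized h g x y + dotp (mu^-1 *: (x - z)) (y - x).
have FE : F = (fun y => F0 y + t^-1 / 2 * enorm (y - x) ^+ 2).
  by apply/funext => w; rewrite /F0 dotpZl.
have cF : curvature_ge t^-1 F.
  have cF0 : curvature_ge 0 F0.
    by apply: curvature_geD_linear; exact: linearized_convex hyp x.
  by have := curvature_geD_sqr t^-1 x cF0; rewrite add0r -FE.
apply: minimizer_growth => //.
have -> : prox_linear_update h g t mu x z = argmin F.
  by congr argmin; apply/funext => w; rewrite invfM (mulrC 2^-1).
apply: argmin_min; rewrite FE.
have [B HB] := linearized_minorant L0 hyp x.
apply: (@exists_minimizer _ _ _ (h (g x)) (B + enorm (mu^-1 *: (x - z)))).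
- move=> y'; apply: (@cvgD _ _ _ (nbhs y')).
    exact: linearized_continuous L0 hyp x y'.
  move: y'; apply: (@elipschitz_continuous _ _ (enorm (mu^-1 *: (x - z)))).
  move=> u v; rewrite -dotpNr -dotpDr opprB addrA subrK.
  rewrite ler_norml cauchy_schwarz andbT.
  by rewrite lerNl -dotpNr -(enormN (u - v)) cauchy_schwarz.
- move=> y'; rewrite /F0; have := HB y'.
  have := cauchy_schwarz (- (mu^-1 *: (x - z))) (y' - x).
  rewrite dotpNl enormN; lra.
by rewrite divr_gt0 ?invr_gt0.
Qed.

(** Since 1/t >= 1/mu + rho, the model minimized by the update lies above the
    proximal objective (up to a constant), while at the proximal point [p] it
    exceeds it by at most (1/t - c)/2 |x - p|^2.  Comparing the two strongly
    convex functions at their minimizers gives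
    (1/t + c) |x' - p|^2 <= (1/t - c) |x - p|^2. *)
Lemma update_contraction x z :
  mu^-1 + L * beta <= t^-1 ->
  (1 + t * (mu^-1 - L * beta))
    * enorm (prox_linear_update h g t mu x z - prox mu (h \o g) z) ^+ 2 <=
  (1 - t * (mu^-1 - L * beta)) * enorm (x - prox mu (h \o g) z) ^+ 2.
Proof.
move=> tmu; have H1 := update_growth x z (prox mu (h \o g) z).
rewrite /prox_linear_model in H1.
have := envelope_growth z (prox_linear_update h g t mu x z) mu0
  (composite_bounded_weakly_convex L0 b0 hyp).
rewrite /envelope; move: H1.
move: (prox_linear_update h g t mu x z) (prox mu (h \o g) z) => x' p H1 H2.
have H3 := linearized_error L0 b0 hyp x x'.
have H4 := linearized_error L0 b0 hyp x p.
have H5 := ler_wpM2r (sqr_ge0 (enorm (x' - x))) tmu.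
rewrite /= in H2; move: H1 H2 H3 H4 H5.
rewrite !ler_norml (enormB p x') (enormB x p).
have distE y : enorm (y - z) ^+ 2 =
    enorm (y - x) ^+ 2 + 2 * dotp (x - z) (y - x) + enorm (x - z) ^+ 2.
  rewrite -[y - z](subrKA x); move: (y - x) (x - z) => u v.
  by rewrite !sqr_enorm !dotpE (dotpC u v); ring.
rewrite (distE x') (distE p) => H1 H2 /andP[_ H3] /andP[H4 _] H5.
set c := mu^-1 - L * beta.
have H6 : (t^-1 + c) * enorm (x' - p) ^+ 2 <= (t^-1 - c) * enorm (p - x) ^+ 2.
  by rewrite /c; lra.
clearbody c; have := ler_wpM2l (ltW t0) H6.
by rewrite !(mulrA t) !(mulrDr t) mulrN divff ?gt_eqF.
Qed.
End update.

(** * Decrease of the potential *)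

(** The splitting of a square used to charge the motion of a proximal point
    and the remaining tracking error separately. *)
Lemma young (R : realType) n (s : R) (u v : 'rV[R]_n) : 0 < s ->
  enorm (u + v) ^+ 2 <= (1 + s) * enorm u ^+ 2 + (1 + s^-1) * enorm v ^+ 2.
Proof.
move=> s0; have := sqr_ge0 (enorm (s *: u - v)).
rewrite -(@ler_pM2l _ s^-1) ?invr_gt0// mulr0 !sqr_enorm !dotpE (dotpC v u).
rewrite (_ : s^-1 * _ = s * dotp u u - 2 * dotp u v + s^-1 * dotp v v).
  by lra.
by rewrite -sqr_enorm; field; exact: lt0r_neq0.
Qed.

(** The two entries of the minimum bound two different losses: the first one
    the second-order term of the descent of the envelope gap, the second one
    the motion of the proximal points, which is harmless if t c = 1 since the
    update then lands on the proximal point.  If t c < 1, the bounds t <= mu and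
    (t c)^2 <= t c show that the radicand is at most
    t^2 c^4 mu^4 / (48 (1 - t c)), which implies the last inequality. *)
Lemma plag_gamma_bounds (R : realType) (t mu rho : R) :
  0 < mu -> 0 < t -> 0 <= rho -> rho < mu^-1 -> mu^-1 + rho <= t^-1 ->
  [/\ 0 < plag_gamma t mu rho,
      8 * plag_gamma t mu rho <= mu ^+ 2 * (mu^-1 - rho) &
      32 * (1 - t * (mu^-1 - rho)) * plag_gamma t mu rho ^+ 2 <=
      3 * (t * (mu^-1 - rho)) ^+ 2 * (mu ^+ 4 * (mu^-1 - rho) ^+ 2)].
Proof.
move=> mu0 t0 r0 rmu tmu.
have muE : mu - mu ^+ 2 * rho = mu ^+ 2 * (mu^-1 - rho).
  by field; exact: lt0r_neq0.
have c0 : 0 < mu^-1 - rho by rewrite subr_gt0.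
have tc1 : t * (mu^-1 - rho) <= 1.
  rewrite -(ler_pM2l t0) divff ?gt_eqF// in tmu.
  by have := mulr_ge0 (ltW t0) r0; lra.
have tlemu : t <= mu.
  by rewrite -(lef_pV2) ?posrE//; lra.
rewrite /plag_gamma muE; move: (mu^-1 - rho) c0 tc1 => c c0 tc1.
have L0 : (4 * (2 / (mu ^+ 2 * c)))^-1 = mu ^+ 2 * c / 8.
  by field; rewrite !lt0r_neq0.
have mc0 : 0 < mu ^+ 2 * c by rewrite mulr_gt0 ?exprn_gt0.
rewrite L0; have [tcE|tc] := eqVneq (t * c) 1.
  rewrite tcE subrr mulr0 mul0r; split; first lra.
    lra.
  by rewrite !mulr_ge0 ?exprn_ge0 ?ltW.
have tclt : t * c < 1 by rewrite lt_neqAle tc.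
have tcgt : 0 < t * c by rewrite mulr_gt0.
have den0 : 0 < 48 * (1 - t ^+ 2 * c ^+ 2).
  by rewrite -exprMn mulr_gt0// subr_gt0 expr_lt1// ltW.
have num0 : 0 < t ^+ 3 * c ^+ 4 * mu ^+ 3 by rewrite !mulr_gt0 ?exprn_gt0.
set rad := _ / (48 * _); have rad0 : 0 < rad by rewrite divr_gt0.
have gle : Num.min (mu ^+ 2 * c / 8) (Num.sqrt rad) <= Num.sqrt rad.
  by rewrite ge_min lexx orbT.
have ggt : 0 < Num.min (mu ^+ 2 * c / 8) (Num.sqrt rad).
  rewrite lt_min sqrtr_gt0; apply/andP.
  by split; [rewrite divr_gt0|exact: rad0].
split => //.
  by rewrite [8 * _]mulrC -ler_pdivlMr// ge_min lexx.
set gam := Num.min _ _ in gle ggt *.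
have g2 : gam ^+ 2 <= rad.
  by rewrite -(sqr_sqrtr (ltW rad0)) ler_pXn2r ?nnegrE ?sqrtr_ge0// ltW.
have : gam ^+ 2 * (48 * (1 - t ^+ 2 * c ^+ 2)) <= t ^+ 3 * c ^+ 4 * mu ^+ 3.
  by rewrite -ler_pdivlMr.
rewrite -exprMn; clearbody gam.
have H1 : t ^+ 3 * c ^+ 4 * mu ^+ 3 <= (t * c) ^+ 2 * (mu ^+ 4 * c ^+ 2).
  have := ler_wpM2l (ltW (_ : 0 < t ^+ 2 * c ^+ 4 * mu ^+ 3)) tlemu.
  rewrite !mulr_gt0 ?exprn_gt0// => /(_ isT).
  lra.
have H2 : gam ^+ 2 * (1 - t * c) <= gam ^+ 2 * (1 - (t * c) ^+ 2).
  by rewrite ler_wpM2l ?sqr_ge0// lerD2l lerN2 expr2 ger_pMl// ltW.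
have H3 : 0 <= (t * c) ^+ 2 * (mu ^+ 4 * c ^+ 2).
  by rewrite !mulr_ge0 ?exprn_ge0 ?ltW.
lra.
Qed.

(** The inequality between the arithmetic and the quadratic mean, in the
    linear form 2 eta u <= u^2 + eta^2. *)
Lemma le_mean_of_sqr (R : realType) (K : nat) (u v : nat -> R) (eta : R) :
  0 < eta -> (forall j, u j ^+ 2 <= v j) ->
  \sum_(j < K) v j <= K%:R * eta ^+ 2 -> \sum_(j < K) u j <= K%:R * eta.
Proof.
move=> eta0 uv H.
rewrite -(@ler_pM2l _ (2 * eta)) ?mulr_gt0//.
apply: (@le_trans _ _ (\sum_(j < K) (v j + eta ^+ 2))).
  rewrite mulr_sumr; apply: ler_sum => j _.
  by have := uv j; have := sqr_ge0 (u j - eta); lra.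
rewrite big_split/= sumr_const card_ord -[_ *+ K]mulr_natl; lra.
Qed.

Lemma sum_residual_le (R : realType) (T : Type) (step : T -> T)
    (Psi res : T -> R) (k B : R) :
  (forall S, Psi (step S) + k * res S <= Psi S) -> (forall S, B <= Psi S) ->
  forall S K, k * (\sum_(j < K) res (iter j step S)) <= Psi S - B.
Proof.
move=> dec lb S K.
apply: (@le_trans _ _ (Psi S - Psi (iter K step S))); last first.
  by rewrite lerD2l lerN2.
elim: K => [|K IH]; first by rewrite big_ord0 mulr0 subrr.
by rewrite big_ord_recr/= mulrDr; have := dec (iter K step S); lra.
Qed.

Section descent.
Context (R : realType) (d m : nat) (L beta Cg : R)
    (h1 h2 : 'rV[R]_m -> R) (g1 g2 : 'rV[R]_d -> 'rV[R]_m)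
    (L0 : 0 <= L) (b0 : 0 <= beta)
    (hyp1 : standing_assumptions L beta Cg h1 g1)
    (hyp2 : standing_assumptions L beta Cg h2 g2)
    (t mu gamma : R) (mu0 : 0 < mu) (t0 : 0 < t)
    (rmu : L * beta < mu^-1) (tmu : mu^-1 + L * beta <= t^-1).

Let c := mu^-1 - L * beta.
Let s := t * c.
Let kappa := gamma / mu ^+ 2.

Context (gam0 : 0 < gamma) (gamL : 8 * gamma <= mu ^+ 2 * c)
  (gams : 32 * (1 - s) * gamma ^+ 2 <= 3 * s ^+ 2 * (mu ^+ 4 * c ^+ 2)).

Let p1 (S : plag_state R d) := prox mu (h1 \o g1) (plag_z S).
Let p2 (S : plag_state R d) := prox mu (h2 \o g2) (plag_z S).
Let step := plag_step h1 h2 g1 g2 t mu gamma.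

(** Chosen so that the gain [tracking_weight * s] on a squared tracking error
    equals twice [kappa] times the contraction factor (1 - s) / (1 + s): it
    pays for the error made in the gradient of the envelope gap. *)
Definition tracking_weight := 2 * kappa * ((1 - s) / (1 + s)) / s.

Definition envelope_gap (S : plag_state R d) :=
  envelope mu (h2 \o g2) (plag_z S) - envelope mu (h1 \o g1) (plag_z S).

Definition potential (S : plag_state R d) :=
  envelope_gap S + tracking_weight *
    (enorm (plag_x1 S - p1 S) ^+ 2 + enorm (plag_x2 S - p2 S) ^+ 2).

Let c0 : 0 < c. Proof. by rewrite subr_gt0. Qed.
Let s0 : 0 < s. Proof. by rewrite mulr_gt0. Qed.
Let s1 : s <= 1.
Proof.
have := tmu; rewrite -(ler_pM2l t0) divff ?gt_eqF// /s /c.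
by have := mulr_ge0 (ltW t0) (mulr_ge0 L0 b0); lra.
Qed.
Let kappa0 : 0 < kappa. Proof. by rewrite divr_gt0 ?exprn_gt0. Qed.

Lemma tracking_weight_ge0 : 0 <= tracking_weight.
Proof.
have := s1; have := s0; have := kappa0 => k0 ss0 ss1.
apply: divr_ge0 (ltW ss0); apply: mulr_ge0; first by rewrite mulr_ge0// ltW.
by apply: divr_ge0; lra.
Qed.

(** One block, before summation.  By [young] with parameter [s] the weight of
    the new error is (1 + s) times the contracted one, that is 1 - s times the
    old one; the gain [s] leaves 2 kappa times the square of the contracted
    error, and the motion of the proximal point costs 3/16 kappa |T|^2. *)
Lemma tracking_decrease (f : 'rV[R]_d -> R) x x' z D T :
  bounded_weakly_convex (L * beta) f ->
  (1 + s) * enorm (x' - prox mu f z) ^+ 2 <=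
    (1 - s) * enorm (x - prox mu f z) ^+ 2 ->
  D = - (gamma / mu) *: T ->
  tracking_weight * enorm (x' - prox mu f (z + D)) ^+ 2
  + 2 * kappa * enorm (x' - prox mu f z) ^+ 2
  <= tracking_weight * enorm (x - prox mu f z) ^+ 2
     + 3 / 16 * kappa * enorm T ^+ 2.
Proof.
move=> af he DE; have := prox_lipschitz (z + D) z mu0 rmu af.
rewrite [z + D - z]addrC addKr -/c; move: he.
move: (prox mu f z) (prox mu f (z + D)) => p p' he Hl.
have Hq : enorm (p' - p) ^+ 2 <= gamma ^+ 2 / (mu ^+ 4 * c ^+ 2) * enorm T ^+ 2.
  have -> : gamma ^+ 2 / (mu ^+ 4 * c ^+ 2) * enorm T ^+ 2 =
      ((mu * c)^-1 * (gamma / mu * enorm T)) ^+ 2.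
    by field; rewrite !lt0r_neq0.
  have g0 : 0 <= gamma / mu by rewrite divr_ge0 ?ltW.
  move: Hl; rewrite DE enormZ normrN (ger0_norm g0) => Hl.
  have := le_trans (enorm_ge0 _) Hl.
  move: Hl; move: (_^-1 * _) => X Hl X0.
  by rewrite ler_pXn2r ?nnegrE ?enorm_ge0.
have Hy := young (x' - p) (p - p') s0.
rewrite subrKA (enormB p p') in Hy.
have H1 := ler_wpM2l tracking_weight_ge0 Hy.
have is0 : 0 <= 1 + s^-1 by rewrite addr_ge0// invr_ge0 ltW.
have H2 := ler_wpM2l (mulr_ge0 tracking_weight_ge0 is0) Hq.
have sp : 0 < 1 + s by rewrite addr_gt0.
have W1 : tracking_weight * s * (1 + s) = 2 * kappa * (1 - s).
  by rewrite /tracking_weight; field; rewrite !lt0r_neq0.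
have W2 : tracking_weight * (1 + s^-1) * (gamma ^+ 2 / (mu ^+ 4 * c ^+ 2))
    <= 3 / 16 * kappa.
  have -> : tracking_weight * (1 + s^-1) * (gamma ^+ 2 / (mu ^+ 4 * c ^+ 2)) =
     kappa / 16 * (32 * (1 - s) * gamma ^+ 2 / (s ^+ 2 * (mu ^+ 4 * c ^+ 2))).
    by rewrite /tracking_weight; field; rewrite !lt0r_neq0.
  rewrite [leRHS](_ : _ = kappa / 16 * 3); last by lra.
  apply: ler_wpM2l; first by apply: divr_ge0 => //; exact: ltW.
  have den0 : 0 < s ^+ 2 * (mu ^+ 4 * c ^+ 2) by rewrite !mulr_gt0 ?exprn_gt0.
  by rewrite (ler_pdivrMr _ _ den0) (mulrA 3).
have H3 := ler_wpM2r (sqr_ge0 (enorm T)) W2.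
have H4 := ler_wpM2l tracking_weight_ge0 he.
have H5 : 2 * kappa * enorm (x' - p) ^+ 2 <=
    tracking_weight * s * enorm (x - p) ^+ 2.
  rewrite -(ler_pM2l sp); have := ler_wpM2l (ltW kappa0) he.
  move: W1; move: tracking_weight kappa (s) => w k r W1.
  move: (enorm (x - p) ^+ 2) (enorm (x' - p) ^+ 2) => X Y.
  have -> : (1 + r) * (w * r * X) = w * r * (1 + r) * X by ring.
  rewrite W1; lra.
move: H1 H2 H3 H4 H5; move: tracking_weight kappa (s) => w k r.
move: (gamma ^+ 2 / _) (enorm T ^+ 2) => Q TT; lra.
Qed.

(** With G = p1 - p2 and T the difference of the updated blocks, the gap
    decreases by kappa <G, T> - kappa/8 |T|^2.  Polarization turns <G, T> into
    half of |G|^2 + |T|^2 - |G - T|^2, the last term being at most twice the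
    sum of the squared tracking errors.  The two blocks return 2 kappa times
    those squares and cost 3/8 kappa |T|^2, so that the terms in |T|^2 cancel
    exactly and kappa times the squares is left over. *)
Lemma potential_decrease S :
  potential (step S) + kappa / 2 * enorm (p1 S - p2 S) ^+ 2
  + kappa * enorm (plag_x1 (step S) - p1 S) ^+ 2 <= potential S.
Proof.
have a1 := composite_bounded_weakly_convex L0 b0 hyp1.
have a2 := composite_bounded_weakly_convex L0 b0 hyp2.
have k1 := update_contraction L0 b0 hyp1 mu0 t0 (plag_x1 S) (plag_z S) tmu.
have k2 := update_contraction L0 b0 hyp2 mu0 t0 (plag_x2 S) (plag_z S) tmu.
rewrite /potential /envelope_gap /p1 /p2 /step /plag_step /=.
move: k1 k2; rewrite -/c -/s.
move: (prox_linear_update h1 _ _ _ _ _) => y1.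
move: (prox_linear_update h2 _ _ _ _ _) => y2.
move=> k1 k2.
pose D : 'rV[R]_d := - (gamma / mu) *: (y1 - y2).
have DE : D = - (gamma / mu) *: (y1 - y2) by [].
have H1 := tracking_decrease a1 k1 DE.
have H2 := tracking_decrease a2 k2 DE.
have := envelope_diff_descent (plag_z S) D mu0 rmu a1 a2.
have -> : plag_z S - gamma / mu *: (y1 - y2) = plag_z S + D.
  by rewrite /D scaleNr.
move: H1 H2 k1 k2.
have -> : D = - (gamma / mu) *: (y1 - y2) by [].
move: (prox mu (h1 \o g1) (plag_z S)) (prox mu (h2 \o g2) (plag_z S)) => q1 q2.
move: (prox mu (h1 \o g1) _) (prox mu (h2 \o g2) _) => r1 r2.
move=> H1 H2 _ _ H3.
have Hyoung := young (q1 - y1) (y2 - q2) ltr01.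
have HGT : q1 - y1 + (y2 - q2) = (q1 - q2) - (y1 - y2).
  by rewrite opprB addrACA [RHS]addrACA [- y1 + _]addrC.
rewrite HGT (enormB q1 y1) !invr1 in Hyoung.
have HGT2 : enorm (q1 - q2 - (y1 - y2)) ^+ 2 =
    enorm (q1 - q2) ^+ 2 - 2 * dotp (q1 - q2) (y1 - y2) + enorm (y1 - y2) ^+ 2.
  move: (q1 - q2) (y1 - y2) => G T.
  by rewrite !sqr_enorm !dotpE (dotpC T G); ring.
rewrite HGT2 in Hyoung.
have g0 : 0 <= gamma / mu by rewrite divr_ge0 ?ltW.
rewrite dotpZr enormZ normrN (ger0_norm g0) in H3.
have H4 : mu^-1 * (- (gamma / mu) * dotp (q1 - q2) (y1 - y2)) =
    - (kappa * dotp (q1 - q2) (y1 - y2)).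
  by rewrite /kappa; field; exact: lt0r_neq0.
have H5 : (mu ^+ 2 * (mu^-1 - L * beta))^-1
      * (gamma / mu * enorm (y1 - y2)) ^+ 2 <= kappa / 8 * enorm (y1 - y2) ^+ 2.
  rewrite exprMn mulrA; apply: ler_wpM2r; first exact: sqr_ge0.
  rewrite -/c mulrC ler_pdivrMr ?mulr_gt0 ?exprn_gt0//.
  have -> : (gamma / mu) ^+ 2 = kappa / 8 * (8 * gamma).
    by rewrite /kappa; field; exact: lt0r_neq0.
  by apply: ler_wpM2l gamL; apply: divr_ge0 => //; exact: ltW.
rewrite H4 in H3.
have {}H3 := le_trans H3 (lerD (lexx _) H5).
have {}Hyoung := ler_wpM2l (ltW kappa0) Hyoung.
have e2 : 0 <= kappa * enorm (y2 - q2) ^+ 2.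
  by apply: mulr_ge0; [exact: ltW|exact: sqr_ge0].
move: H1 H2 H3 Hyoung e2; move: tracking_weight kappa => w k.
lra.
Qed.

(** An envelope of a bounded function lies between the bounds of that
    function. *)
Lemma potential_lower_bound : exists B, forall S, B <= potential S.
Proof.
have a1 := composite_bounded_weakly_convex L0 b0 hyp1.
have a2 := composite_bounded_weakly_convex L0 b0 hyp2.
have [_ [B1 f1B] _] := a1; have [_ [B2 f2B] _] := a2.
exists (- B2 - B1) => S.
have H1 := envelope_le (plag_z S) (plag_z S) mu0 (ltW rmu) a1.
rewrite subrr enorm0 expr0n/= mulr0 addr0 in H1.
have H1' := le_trans (ler_norm _) (f1B (plag_z S)).
have H2 : - B2 <= envelope mu (h2 \o g2) (plag_z S).
  rewrite /envelope; have := f2B (prox mu (h2 \o g2) (plag_z S)).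
  rewrite ler_norml => /andP[H _]; apply: le_trans H _.
  by rewrite lerDl mulr_ge0 ?sqr_ge0// divr_ge0 ?invr_ge0 ?ltW.
have H3 : 0 <= tracking_weight *
    (enorm (plag_x1 S - p1 S) ^+ 2 + enorm (plag_x2 S - p2 S) ^+ 2).
  by rewrite mulr_ge0 ?tracking_weight_ge0 ?addr_ge0 ?sqr_ge0.
rewrite /potential /envelope_gap /= in H1' *; lra.
Qed.

Lemma residuals_summable S0 :
  exists2 C, 0 <= C & forall K,
    \sum_(j < K) (enorm (p1 (iter j step S0) - p2 (iter j step S0)) ^+ 2 +
      enorm (plag_x1 (iter j.+1 step S0) - p1 (iter j step S0)) ^+ 2) <= C.
Proof.
have [B HB] := potential_lower_bound.
have k2 : 0 < kappa / 2 by apply: divr_gt0.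
exists ((potential S0 - B) / (kappa / 2)).
  by apply: divr_ge0; [rewrite subr_ge0|exact: ltW].
move=> K; rewrite (ler_pdivlMr _ _ k2) mulrC.
pose res S := enorm (p1 S - p2 S) ^+ 2 + enorm (plag_x1 (step S) - p1 S) ^+ 2.
apply: (sum_residual_le (res := res)) HB S0 K => S.
apply: le_trans (potential_decrease S); rewrite /res mulrDr addrA lerD2l.
apply: ler_wpM2r; first exact: sqr_ge0.
by have := kappa0; lra.
Qed.
End descent.

(** * Sampling the iterate *)

Lemma random_vector_comp_nat (R : realType) n disp (T : measurableType disp)
    (tau : T -> nat) (phi : nat -> 'rV[R]_n) :
  measurable_fun [set: T] tau -> random_vector (fun w => phi (tau w)).
Proof.
by move=> mtau mT Y mY; exact: (mtau mT (phi @^-1` Y)).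
Qed.

(** Cut the sample space along the values of [tau]; the values outside
    1, ..., K have probability 0, so the resulting series is a finite sum. *)
Lemma expectation_uniform (R : realType) disp (T : measurableType disp)
    (P : probability T R) (K : nat) (tau : T -> nat) (phi : nat -> R) :
  (forall k, 0 <= phi k) -> uniform_on_1_to P K tau ->
  ('E_P[fun w => phi (tau w)])%E = (K%:R^-1 * \sum_(j < K) phi j.+1)%:E.
Proof.
move=> phi0 [mtau Ptau]; rewrite unlock.
pose A k := tau @^-1` [set k].
have mA k : measurable (A k) by rewrite -[A k]setTI; exact: mtau.
have -> : [set: T] = \bigcup_k A k.
  by apply/esym/seteqP; split => // w _; exists (tau w).
rewrite ge0_integral_bigcup//; last 3 first.
- apply: (@measurable_funS _ _ _ _ setT) => //.
  move=> mT Y mY; exact: (mtau mT ((fun k => (phi k)%:E) @^-1` Y)).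
- by move=> w _; rewrite lee_fin.
- apply/trivIsetP => i j _ _ ij; apply/seteqP; split => // w [/= wi wj].
  by move: ij; rewrite -wi -wj eqxx.
have intA k : (\int[P]_(w in A k) (phi (tau w))%:E)%E =
    (phi k * (if (1 <= k <= K)%N then K%:R^-1 else 0))%:E.
  rewrite (eq_integral (cst (phi k)%:E)); last by move=> w; rewrite inE => ->.
  by rewrite integral_cst// EFinM; congr (_ * _)%E; exact: Ptau.
under eq_eseriesr do rewrite intA.
rewrite (@nneseries_split _ _ 0 K.+1); last first.
  by move=> k _; rewrite lee_fin mulr_ge0//; case: ifP.
rewrite eseries0 ?adde0 => [|k Kk _]; last first.
  by rewrite add0n in Kk; rewrite [(k <= K)%N]leqNgt Kk andbF mulr0.
rewrite add0n big_mkord sumEFin big_ord_recl/= mulr0 add0r mulr_sumr.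
by congr EFin; apply: eq_bigr => j _; rewrite /bump/= add1n ltn_ord mulrC.
Qed.

Theorem theorem5p8 (R : realType) (d m : nat) (L beta Cg : R)
    (h1 h2 : 'rV[R]_m -> R) (g1 g2 : 'rV[R]_d -> 'rV[R]_m)
    (mu t : R) (x1 x2 z : 'rV[R]_d)
    (hL : 0 <= L) (hbeta : 0 <= beta)
    (hyp1 : standing_assumptions L beta Cg h1 g1)
    (hyp2 : standing_assumptions L beta Cg h2 g2)
    (hmu : 0 < mu) (ht : 0 < t) :
  let rho := L * beta in
  let gamma := plag_gamma t mu rho in
  Num.max 1 rho < mu^-1 ->
  mu^-1 + rho <= t^-1 ->
  exists M : R, forall eps : R, 0 < eps <= 1 ->
    exists K : nat,
      [/\ (1 <= K)%N,
          K%:R <= M / eps ^+ 2 &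
          forall (disp : measure_display) (T : measurableType disp)
            (P : probability T R) (tau : T -> nat),
            uniform_on_1_to P K tau ->
            stochastic_nearly_critical P (h1 \o g1) (h2 \o g2) (2 * eps)
              (fun w => plag_x1 (plag_iterate h1 h2 g1 g2 t mu gamma
                                   (PlagState x1 x2 z) (tau w)))].
Proof.
move=> rho gamma; rewrite gt_max => /andP[mu1 rmu] tmu.
have [gam0 gamL gams] :=
  plag_gamma_bounds hmu ht (mulr_ge0 hL hbeta) rmu tmu.
have a1 := composite_bounded_weakly_convex hL hbeta hyp1.
have a2 := composite_bounded_weakly_convex hL hbeta hyp2.
have [C C0 HC] := residuals_summable hL hbeta hyp1 hyp2 hmu ht rmu tmu
  gam0 gamL gams (PlagState x1 x2 z).
have mu2 : 0 < mu ^+ 2 by rewrite exprn_gt0.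
exists (C / mu ^+ 2 + 1) => eps /andP[e0 e1].
have e2 : 0 < eps ^+ 2 by rewrite exprn_gt0.
(* The real number of iterations for which K * (mu * eps) ^+ 2 is the bound
   C on the sum of the squared residuals. *)
pose X := C / mu ^+ 2 / eps ^+ 2.
have X0 : 0 <= X by exact: divr_ge0 (divr_ge0 C0 (ltW mu2)) (ltW e2).
pose K := (Num.truncn X).+1.
have K0 : 0 < K%:R :> R by rewrite ltr0n.
exists K; split => //.
  rewrite /K -natr1 mulrDl -/X lerD ?truncn_le//.
  by rewrite mul1r invf_ge1// expr_le1// ltW.
move=> disp T P tau utau; have mtau := utau.1.
(* The output at tau = k is produced from the state number k - 1, whose z
   is the center of the proximal points; at k = 0, outside the support of
   tau, any state will do. *)
pose it k := plag_iterate h1 h2 g1 g2 t mu gamma (PlagState x1 x2 z) k.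
pose q1 k := prox mu (h1 \o g1) (plag_z (it k.-1)).
pose q2 k := prox mu (h2 \o g2) (plag_z (it k.-1)).
pose xi (q : nat -> 'rV[R]_d) k := mu^-1 *: (plag_z (it k.-1) - q k).
pose G j := enorm (q1 j.+1 - q2 j.+1).
pose E j := enorm (plag_x1 (it j.+1) - q1 j.+1).
have Csum : \sum_(j < K) (G j ^+ 2 + E j ^+ 2) <= K%:R * (mu * eps) ^+ 2.
  apply: le_trans (HC K) _.
  rewrite exprMn -ler_pdivrMr ?mulr_gt0// invfM mulrA.
  exact: ltW (truncnS_gt X).
have me0 : 0 < mu * eps by rewrite mulr_gt0.
have GK : \sum_(j < K) G j <= K%:R * (mu * eps).
  apply: (le_mean_of_sqr (v := fun j => G j ^+ 2 + E j ^+ 2)) me0 _ Csum => j.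
  by rewrite /= lerDl sqr_ge0.
have EK : \sum_(j < K) E j <= K%:R * (mu * eps).
  apply: (le_mean_of_sqr (v := fun j => G j ^+ 2 + E j ^+ 2)) me0 _ Csum => j.
  by rewrite /= lerDr sqr_ge0.
have mule : mu * eps <= eps.
  by rewrite ger_pMl// ltW// -[mu]invrK invf_lt1// (lt_trans ltr01 mu1).
have mean_le (phi : nat -> R) : (forall k, 0 <= phi k) ->
    \sum_(j < K) phi j.+1 <= K%:R * (2 * eps) ->
    ('E_P[fun w => phi (tau w)] <= (2 * eps)%:E)%E.
  by move=> phi0 H; rewrite (expectation_uniform phi0 utau) lee_fin ler_pdivrMl.
split; first exact: (random_vector_comp_nat (fun k => plag_x1 (it k)) mtau).
exists (fun w => xi q1 (tau w)), (fun w => xi q2 (tau w)),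
  (fun w => q1 (tau w)), (fun w => q2 (tau w)); split.
- by split; exact: (random_vector_comp_nat _ mtau).
- by move=> w; exact: prox_subdiff hmu (ltW rmu) a1.
- by move=> w; exact: prox_subdiff hmu (ltW rmu) a2.
rewrite !ge_max -!andbA; apply/and3P; split.
- apply: (mean_le (fun k => enorm (xi q1 k - xi q2 k))) => [k|].
    exact: enorm_ge0.
  have xiE j : enorm (xi q1 j.+1 - xi q2 j.+1) = mu^-1 * G j.
    rewrite /xi -scalerBr enormZ gtr0_norm ?invr_gt0//.
    by rewrite opprB addrC -addrA addKr enormB.
  under eq_bigr do rewrite xiE.
  rewrite -mulr_sumr ler_pdivrMl//.
  by apply: le_trans GK _; have := mulr_gt0 K0 me0; lra.
- apply: (mean_le (fun k => enorm (plag_x1 (it k) - q1 k))) => [k|].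
    exact: enorm_ge0.
  by apply: le_trans EK _; rewrite ler_pM2l//; lra.
- apply: (mean_le (fun k => enorm (plag_x1 (it k) - q2 k))) => [k|].
    exact: enorm_ge0.
  apply: (@le_trans _ _ (\sum_(j < K) (E j + G j))).
    apply: ler_sum => j _; rewrite -(subrKA (q1 j.+1)).
    exact: ler_enormD.
  rewrite big_split/=; have := ler_wpM2l (ltW K0) mule.
  by move: EK GK; lra.
Qed.
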